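(* $\mathcal{I}_{1,0} = \mathcal{ID} \cap \mathcal{A}$.
   Context: An implicator groupoid is an algebra $\mathbf A = \langle A, \to, 0 \rangle$, with $\to$ binary and $0$ a constant, which, writing $x' := x \to 0$, satisfies the identities (I) $(x \to y) \to z \approx [(z' \to x) \to (y \to z)']'$ and (I$_0$) $0'' \approx 0$. $\mathcal{I}_{1,0}$, $\mathcal{ID}$, $\mathcal{A}$ are the varieties of implicator groupoids satisfying, respectively, $x' \approx x$; $x \to x \approx x$; $(x \to y) \to z \approx x \to (y \to z)$. *)

(* Defs.v *)
From mathcomp Require Import classical_sets.

Set Implicit Arguments.
Unset Strict Implicit.
Unset Printing Implicit Defensive.

Local Open Scope classical_set_scope.

Declare Scope implicator_scope.
Delimit Scope implicator_scope with implicator.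
Local Open Scope implicator_scope.

Reserved Notation "x ~> y" (at level 55, no associativity).

(* [neg x] is the derived operation x' := x ~> 0. *)
Record implicator_groupoid := ImplicatorGroupoid {
  carrier :> Type;
  imp : carrier -> carrier -> carrier where "x ~> y" := (imp x y);
  ig0 : carrier;
  neg (x : carrier) : carrier := x ~> ig0;
  axiom_I : forall x y z : carrier,
    (x ~> y) ~> z = neg ((neg z ~> x) ~> neg (y ~> z));
  axiom_I0 : neg (neg ig0) = ig0
}.

Notation "x ~> y" := (imp x y) : implicator_scope.

Definition variety_I10 : set implicator_groupoid :=
  [set A : implicator_groupoid | forall x : A, neg x = x].

Definition variety_ID : set implicator_groupoid :=
  [set A : implicator_groupoid | forall x : A, x ~> x = x].

Definition variety_A : set implicator_groupoid :=
  [set A : implicator_groupoid | forall x y z : A, (x ~> y) ~> z = x ~> (y ~> z)].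

(* Main.v *)
Require Import Defs.
From mathcomp Require Import classical_sets.
From Corelib Require Import ssreflect.

Local Open Scope classical_set_scope.
Local Open Scope implicator_scope.

(** Write [x ~> y] as a product [xy].

    If [x' = x], then 0 is a right unit and (I) loses its primes:
    [(xy)z = (zx)(yz)].  Setting variables to 0 shows that 0 is also a left
    unit and that the product satisfies [zz = z], [z(yz) = yz] and
    [(zx)z = xz].  Associativity comes from applying the reduced (I) twice, the
    second time with [yz] in the role of [z]:
    [(xy)z = (zx)(yz) = ((yz)z)(x(yz)) = (yz)(x(yz)) = x(yz)].

    Conversely, in an idempotent associative implicator groupoid, (I) reads
    [xyz = z0xyz0] (the final 00 collapses to 0).  At [x = y = z] the right
    side is [(z0)(z0) = z0] by idempotence, so [z = z0 = z']. *)

Section NegTrivial.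

Variable A : implicator_groupoid.
Hypothesis negx : forall x : A, neg x = x.

Lemma imp_neg_trivial (x y z : A) : (x ~> y) ~> z = (z ~> x) ~> (y ~> z).
Proof. by rewrite axiom_I !negx. Qed.

Lemma impx0 (x : A) : x ~> ig0 A = x.
Proof. exact: negx. Qed.

Lemma imp0x (x : A) : ig0 A ~> x = x.
Proof.
by have := imp_neg_trivial x (ig0 A) (ig0 A); rewrite !impx0 => <-.
Qed.

Lemma imp_absorb_right (y z : A) : z ~> (y ~> z) = y ~> z.
Proof.
by have := imp_neg_trivial (ig0 A) y z; rewrite imp0x impx0.
Qed.

Lemma imp_idem (z : A) : z ~> z = z.
Proof. by have := imp_absorb_right (ig0 A) z; rewrite imp0x. Qed.

Lemma imp_absorb_left (x z : A) : (z ~> x) ~> z = x ~> z.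
Proof. by rewrite imp_neg_trivial imp_idem imp_absorb_right. Qed.

Lemma imp_assoc (x y z : A) : (x ~> y) ~> z = x ~> (y ~> z).
Proof.
have yzz : (y ~> z) ~> z = y ~> z.
  by rewrite imp_neg_trivial imp_idem imp_absorb_left.
by rewrite imp_neg_trivial imp_neg_trivial yzz imp_absorb_right.
Qed.

End NegTrivial.

Lemma neg_trivial_of_band (A : implicator_groupoid) :
  (forall x : A, x ~> x = x) ->
  (forall x y z : A, (x ~> y) ~> z = x ~> (y ~> z)) ->
  forall x : A, neg x = x.
Proof.
move=> idem assoc z.
rewrite /neg; have := axiom_I z z z; rewrite /neg !idem.
have -> : ((z ~> ig0 A) ~> z) ~> (z ~> ig0 A) = z ~> ig0 A.
  by rewrite assoc -(assoc z z) idem idem.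
by rewrite assoc idem => <-.
Qed.

Theorem theorem9p3 : variety_I10 = variety_ID `&` variety_A.
Proof.
apply/seteqP; split=> [A negx | A [idem assoc]].
- by split; [exact: imp_idem | exact: imp_assoc].
- exact: neg_trivial_of_band.
Qed.
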